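(* Let $\mathcal H$ be a real separable Hilbert space, let $T:\mathcal H\to\mathcal H$ be $\alpha$-averaged for some $\alpha\in(0,1]$ with $\operatorname{fix}T\ne\emptyset$, and let $R=\mathrm{id}-T$. Suppose that $x,w\in\mathcal H$ are such that $$\rho:=\|Rw\|^2-2\alpha\langle Rw,\,w-x\rangle>0 .$$ For $\lambda\in[0,1/\alpha]$ let $$x^+:=x-\lambda\frac{\rho}{\|Rw\|^2}Rw .$$ Then: (i) $x^+=\Pi_{C_w,2\alpha\lambda}\,x$, where $C_w:=\{z\in\mathcal H:\ \|Rw\|^2-2\alpha\langle Rw,\,w-z\rangle\le0\}$; (ii) $\displaystyle\|x^+-z\|^2\le\|x-z\|^2-\lambda\Bigl(\frac1\alpha-\lambda\Bigr)\frac{\rho^2}{\|Rw\|^2}$ for all $z\in\operatorname{fix}T$.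
   Context: An operator $T$ is nonexpansive if $\|Tx-Ty\|\le\|x-y\|$ for all $x,y\in\mathcal H$; it is $\alpha$-averaged, $\alpha\in(0,1)$, if $T=(1-\alpha)\mathrm{id}+\alpha S$ for some nonexpansive $S:\mathcal H\to\mathcal H$; $1$-averaged means nonexpansive. $\operatorname{fix}T=\{z: Tz=z\}$. For a nonempty closed convex set $C$, $\Pi_C$ is the projection onto $C$, and for $\mu\in\mathbb R$, $\Pi_{C,\mu}:=(1-\mu)\mathrm{id}+\mu\,\Pi_C$. *)

(* Defs.v *)
From HB Require Import structures.
From mathcomp Require Import all_boot all_order all_algebra.
From mathcomp Require Import all_classical all_reals all_analysis.

Set Implicit Arguments.
Unset Strict Implicit.
Unset Printing Implicit Defensive.

Import Order.TTheory GRing.Theory Num.Theory.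
Import numFieldNormedType.Exports.

Local Open Scope classical_set_scope.
Local Open Scope ring_scope.

Definition separable (X : topologicalType) : Prop :=
  exists2 D : set X, countable D & dense D.

(* A real Hilbert space is a complete normed module together with a symmetric
   positive definite bilinear form [dot] that induces its norm. *)
Definition induces_norm (R : realType) (H : completeNormedModType R)
    (dot : {dot H for idfun}) : Prop :=
  forall u : H, `|u| ^+ 2 = dot u u.

Section Operators.
Context {R : realType} {H : completeNormedModType R}.
Implicit Types (T : H -> H) (C : set H).

Definition nonexpansive T : Prop := forall x y, `|T x - T y| <= `|x - y|.

Definition averaged (alpha : R) T : Prop :=
  (0 < alpha < 1 /\
    exists2 S : H -> H, nonexpansive S &
      forall x, T x = (1 - alpha) *: x + alpha *: S x)
  \/ (alpha = 1 /\ nonexpansive T).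

Definition fix_set T : set H := [set z | T z = z].

Definition nearest_point C (x : H) : set H :=
  [set p | C p /\ forall y, C y -> `|x - p| <= `|x - y|].

(* The nearest point exists and is unique when [C] is nonempty, closed and
   convex in a Hilbert space; the default value [0] is irrelevant there. *)
Definition proj C (x : H) : H := xget 0 (nearest_point C x).

Definition relaxed_proj C (mu : R) (x : H) : H :=
  (1 - mu) *: x + mu *: proj C x.

End Operators.

(* Main.v *)
Require Import Defs.
From HB Require Import structures.
From mathcomp Require Import all_boot all_order all_algebra.
From mathcomp Require Import all_classical all_reals all_analysis.
From mathcomp Require Import ring lra.

Set Implicit Arguments.
Unset Strict Implicit.
Unset Printing Implicit Defensive.

Import Order.TTheory GRing.Theory Num.Theory.
Import numFieldNormedType.Exports.

Local Open Scope classical_set_scope.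
Local Open Scope ring_scope.

(** The geometric content is that [fix T] lies in the half-space [Cw].  Write
    [T = (1 - alpha) id + alpha S] with [S] nonexpansive, so that
    [res w = alpha (w - S w)]; expanding [|S w - z| <= |w - z|] for a fixed point
    [z] gives [|res w|^2 <= 2 alpha <res w, w - z>], which is [z \in Cw]
    ([averaged_residual_dot]).

    Since [Cw] is a half-space with normal [res w], projecting [x] onto it
    subtracts the excess [rho / (2 alpha)] of [<res w, .>], divided by [|res w|^2],
    along [res w] ([proj_halfspace]).  Relaxing this projection by
    [2 alpha lambda] cancels the factor [2 alpha] and yields [xp].

    For the norm inequality, expand the square of [xp - z].  The cross term is controlled by
    [rho <= 2 alpha <res w, x - z>], which is the membership of [z] in [Cw]
    rewritten around [x] instead of [w]. *)

Section HalfSpaces.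
Variables (R : realType) (H : completeNormedModType R).
Variables (dot : {dot H for idfun}) (dot_norm : induces_norm dot).

Lemma dotC (u v : H) : dot u v = dot v u.
Proof. by rewrite hermC expr0 mul1r. Qed.

Lemma sqr_normB (u v : H) :
  `|u - v| ^+ 2 = `|u| ^+ 2 + `|v| ^+ 2 - 2 * dot u v.
Proof.
rewrite !dot_norm linearBl !linearBr /= (dotC v u).
by ring.
Qed.

Lemma dotZr (a : R) (u v : H) : dot u (a *: v) = a * dot u v.
Proof. by rewrite linearZr_LR. Qed.

(** By polarization [dot r] is a combination of norms, which are continuous;
    this avoids the Cauchy-Schwarz inequality. *)
Lemma dot_continuous (r : H) : continuous (dot r).
Proof.
have -> : (dot r : H -> R) =
    fun z => 2^-1 * (`|r| ^+ 2 + `|z| ^+ 2 - `|r - z| ^+ 2).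
  by apply/funext => z; rewrite sqr_normB; field.
move=> z; apply: cvgM; first exact: cvg_cst.
apply: cvgB; last first.
  rewrite expr2.
  by apply: cvgM; apply: cvg_norm; apply: cvgB => //; exact: cvg_cst.
apply: cvgD; first exact: cvg_cst.
by rewrite expr2; apply: cvgM; apply: cvg_norm; exact: cvg_id.
Qed.

Lemma closed_halfspace (r : H) (b : R) : closed [set z | dot r z <= b].
Proof.
apply: (@preimage_closed _ _ (dot r) [set t | t <= b]); last exact: closed_le.
by move=> z _; exact: dot_continuous.
Qed.

Lemma convex_halfspace (r : H) (b : R) : convex_set [set z : H | dot r z <= b].
Proof.
move=> x y k; rewrite !inE /= => xb yb.
rewrite linearDr /= !dotZr.
have k0 : 0 <= k%:num by [].
have k1 : k%:num <= 1 by [].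
rewrite /unstable.onem; nra.
Qed.

(** A point satisfying the variational inequality is nearest, and the squared
    distance from [x] to any other point [y] of [C] is larger by at least
    [|y - p|^2]; hence [p] is the only candidate for the choice in [proj]. *)
Lemma proj_variational (C : set H) (x p : H) : C p ->
  (forall y, C y -> dot (x - p) (y - p) <= 0) -> Defs.proj C x = p.
Proof.
move=> Cp varp.
have far y : C y -> `|x - p| ^+ 2 + `|y - p| ^+ 2 <= `|x - y| ^+ 2.
  move=> Cy; have := varp y Cy.
  have -> : x - y = (x - p) - (y - p) by rewrite opprB addrA subrK.
  rewrite (sqr_normB (x - p)); lra.
apply: xget_unique => [|y [Cy nearest_y]].
  split=> // y Cy; rewrite -(@ler_pXn2r _ 2) ?nnegrE //.
  by apply: le_trans (far y Cy); rewrite lerDl sqr_ge0.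
have := far y Cy; have := nearest_y p Cp.
rewrite -(@ler_pXn2r _ 2) ?nnegrE // => le_yp le_py.
apply/eqP; rewrite -subr_eq0 -normr_eq0 -sqrf_eq0 eq_le sqr_ge0 andbT.
lra.
Qed.

Lemma proj_halfspace (r x : H) (b : R) : r != 0 -> b <= dot r x ->
  Defs.proj [set z | dot r z <= b] x = x - ((dot r x - b) / `|r| ^+ 2) *: r.
Proof.
move=> r0 bx; have n0 : 0 < `|r| ^+ 2 by rewrite exprn_gt0 // normr_gt0.
(* The foot of the projection lies on the bounding hyperplane. *)
have foot : dot r (x - ((dot r x - b) / `|r| ^+ 2) *: r) = b.
  by rewrite linearBr /= dotZr -dot_norm divfK ?gt_eqF // opprB addrC subrK.
apply: proj_variational => [|y /= yb]; first by rewrite /= foot.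
rewrite subKr (dotC (_ *: r)) dotZr (dotC _ r) linearBr /= foot.
by rewrite mulr_ge0_le0 ?subr_le0 // divr_ge0 ?subr_ge0 // ltW.
Qed.

End HalfSpaces.

Section Averaged.
Variables (R : realType) (H : completeNormedModType R).
Variables (dot : {dot H for idfun}) (dot_norm : induces_norm dot).

Lemma averagedP (alpha : R) (T : H -> H) : averaged alpha T ->
  exists2 S : H -> H, nonexpansive S &
    forall x, T x = (1 - alpha) *: x + alpha *: S x.
Proof.
case=> [[_ //]|[-> neT]]; exists T => // x.
by rewrite subrr scale0r add0r scale1r.
Qed.

(** With [T = (1 - alpha) id + alpha S] the residual [w - T w] is
    [alpha *: (w - S w)] and fixed points of [T] are fixed by [S], so the bound
    is the expansion of [|S w - z|^2 <= |w - z|^2]. *)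
Lemma averaged_residual_dot (alpha : R) (T : H -> H) (w z : H) :
  0 < alpha -> averaged alpha T -> fix_set T z ->
  `|w - T w| ^+ 2 <= 2 * alpha * dot (w - T w) (w - z).
Proof.
move=> a0 /averagedP[S neS TE] /= fixz.
have resE u : u - T u = alpha *: (u - S u).
  by rewrite TE scalerBl scale1r scalerBr opprD opprB addrA (addrC u) subrK.
have Sz : S z = z.
  have /eqP := resE z; rewrite fixz subrr eq_sym scaler_eq0 gt_eqF //=.
  by rewrite subr_eq0 => /eqP.
have := neS w z; rewrite Sz -(@ler_pXn2r _ 2) ?nnegrE //.
have -> : S w - z = (w - z) - (w - S w).
  by rewrite opprB [RHS]addrC addrA subrK.
rewrite (sqr_normB dot_norm (w - z)) => le_Sw.
rewrite resE normrZ exprMn (ger0_norm (ltW a0)) (dotC dot) dotZr.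
have -> : 2 * alpha * (alpha * dot (w - z) (w - S w))
        = alpha ^+ 2 * (2 * dot (w - z) (w - S w)) by ring.
by rewrite ler_pM2l ?exprn_gt0 //; lra.
Qed.

End Averaged.

Theorem propositionV2 (R : realType) (H : completeNormedModType R)
    (dot : {dot H for idfun}) (dot_norm : induces_norm dot)
    (sepH : separable H)
    (T : H -> H) (alpha : R) (alpha01 : 0 < alpha <= 1)
    (avgT : averaged alpha T) (fixT : fix_set T !=set0) (x w : H) :
  let res := fun u : H => u - T u in
  let rho := `|res w| ^+ 2 - 2 * alpha * dot (res w) (w - x) in
  0 < rho ->
  forall lambda : R, 0 <= lambda <= 1 / alpha ->
  let xp := x - (lambda * (rho / `|res w| ^+ 2)) *: res w in
  let Cw := [set z : H |
    `|res w| ^+ 2 - 2 * alpha * dot (res w) (w - z) <= 0] in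
  ([/\ Cw !=set0, closed Cw, convex_set Cw
     & xp = relaxed_proj Cw (2 * alpha * lambda) x])
  /\ (forall z : H, fix_set T z ->
       `|xp - z| ^+ 2 <= `|x - z| ^+ 2
         - lambda * (1 / alpha - lambda) * (rho ^+ 2 / `|res w| ^+ 2)).
Proof.
move=> res rho rho_gt0 lambda /andP[l0 _] xp Cw.
have a0 : 0 < alpha by case/andP: alpha01.
set r := res w in rho rho_gt0 xp Cw *.
have r0 : r != 0.
  apply: contraTneq rho_gt0 => rE; rewrite /rho rE.
  by rewrite normr0 linear0l expr0n /= mulr0 subr0 ltxx.
have n0 : 0 < `|r| ^+ 2 by rewrite exprn_gt0 // normr_gt0.
have fixP z : fix_set T z -> `|r| ^+ 2 <= 2 * alpha * dot r (w - z).
  exact: averaged_residual_dot.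
pose b := dot r w - `|r| ^+ 2 / (2 * alpha).
have CwE : Cw = [set z | dot r z <= b].
  apply/seteqP; split=> z; rewrite /Cw /= linearBr /= /b lerBrDr -lerBrDl.
    by move=> h; rewrite ler_pdivrMr ?mulr_gt0 //; lra.
  by rewrite ler_pdivrMr ?mulr_gt0 //; lra.
have rhoE : rho = 2 * alpha * (dot r x - b).
  by rewrite /rho /b linearBr /=; field; rewrite gt_eqF.
split; first split.
- by have [z /fixP zP] := fixT; exists z; rewrite /Cw /= subr_le0.
- by rewrite CwE; exact: closed_halfspace.
- by rewrite CwE; exact: convex_halfspace.
- have bx : b <= dot r x.
    by move: rho_gt0; rewrite rhoE pmulr_rgt0 ?mulr_gt0 // subr_gt0 => /ltW.
  rewrite /relaxed_proj CwE (proj_halfspace dot_norm) //.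
  rewrite scalerBr addrA -scalerDl subrK scale1r scalerA /xp rhoE.
  by congr (_ - _ *: _); ring.
move=> z /fixP zP.
(* The two occurrences of [w] cancel, leaving a bound on the cross term. *)
have cross : rho / (2 * alpha) <= dot r (x - z).
  rewrite ler_pdivrMr ?mulr_gt0 //; move: zP.
  by rewrite /rho !linearBr /=; lra.
set c := lambda * (rho / `|r| ^+ 2).
have c0 : 0 <= c by rewrite mulr_ge0 // divr_ge0 // ltW.
have -> : xp - z = (x - z) - c *: r by rewrite /xp addrAC.
rewrite (sqr_normB dot_norm) dotZr (dotC dot) normrZ exprMn (ger0_norm c0).
have -> : lambda * (1 / alpha - lambda) * (rho ^+ 2 / `|r| ^+ 2)
        = 2 * (c * (rho / (2 * alpha))) - c ^+ 2 * `|r| ^+ 2.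
  by rewrite /c; field; rewrite normr_eq0 r0 gt_eqF.
have := ler_wpM2l c0 cross; lra.
Qed.
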